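(* Let $N\geq 1$ and $m\geq 1$ be integers, and let $k_1,\dots,k_N\geq 1$ be integers defining the degree function $\deg(e_i)=k_i$. Let $\mu$ be a finite, positive Borel measure on $\mathbb{R}^N$ concentrated in a Borel set $A\subset\mathbb{R}^N$, i.e. $\mu(\mathbb{R}^N\setminus A)=0$, such that $$\int_{\mathbb{R}^N}|x_{i_1}\cdots x_{i_l}|\,\mu(dx)<\infty$$ for all $l\geq 0$ and all $(i_1,\dots,i_l)\in\{1,\dots,N\}^l$ with $\sum_{r=1}^l k_{i_r}\leq m$. Then there exist an integer $k$ with $1\leq k\leq \dim\mathbb{A}^N_{\deg\leq m}$, points $x_1,\dots,x_k\in A$ and weights $\lambda_1,\dots,\lambda_k>0$ such that $$\int_{\mathbb{R}^N}P(x)\,\mu(dx)=\sum_{i=1}^k\lambda_i P(x_i)$$ for all $P\in\mathbb{A}^N_{\deg\leq m}$.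
   Context: Consider real polynomials in $N$ commuting variables $e_1,\dots,e_N$, with degree function given by $\deg(e_i):=k_i$ for integers $k_i\geq 1$. The degree of a monomial $e_{i_1}\cdots e_{i_l}$ with $(i_1,\dots,i_l)\in\{1,\dots,N\}^l$, $l\geq 0$, is $\deg(e_{i_1}\cdots e_{i_l})=\sum_{r=1}^l k_{i_r}$; the monomial associated to the empty sequence ($l=0$) is $1$, of degree $0$. $\mathbb{A}^N_{\deg\leq m}$ denotes the real vector space of polynomials spanned by the monomials of degree less than or equal to $m$, and $\dim\mathbb{A}^N_{\deg\leq m}$ is its dimension over $\mathbb{R}$. For $P\in\mathbb{A}^N_{\deg\leq m}$ and $x=(x_1,\dots,x_N)\in\mathbb{R}^N$, $P(x)$ is the value obtained by substituting $e_i=x_i$. In the integrability condition $x_{i}$ denotes the $i$-th coordinate of $x\in\mathbb{R}^N$, whereas in the conclusion $x_1,\dots,x_k$ denote points of $\mathbb{R}^N$.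
   Formalization: The measure μ is additionally assumed to be nonzero, μ(R^N) > 0: for μ = 0 the claim fails, since P = 1 would give 0 as a sum of k ≥ 1 strictly positive weights. *)

(* Defs.v *)
From HB Require Import structures.
From mathcomp Require Import all_boot all_order all_algebra.
From mathcomp Require Import mpoly.

Set Implicit Arguments.
Unset Strict Implicit.
Unset Printing Implicit Defensive.

Import GRing.Theory.
Local Open Scope ring_scope.

(* mpoly is imported here only: its notations cannot be loaded together with
   those of MathComp-Analysis. *)

Section WeightedDegree.
Context (N : nat) (k : 'I_N -> nat).

(* The commutative monomial e_1^(a 1) ... e_N^(a N) has degree
   \sum_i k i * a i; see [wdeg_word] for monomials given as words. *)
Definition wdeg (a : 'X_{1..N}) : nat := (\sum_(i < N) k i * a i)%N.

Lemma wdeg_word (l : nat) (i : 'I_l -> 'I_N) :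
  wdeg (\sum_(r < l) U_(i r))%MM = (\sum_(r < l) k (i r))%N.
Proof.
rewrite /wdeg; under eq_bigr => j _ do rewrite mnm_sumE big_distrr /=.
rewrite exchange_big /=; apply: eq_bigr => r _.
rewrite (bigD1 (i r)) //= mnm1E eqxx muln1 big1 ?addn0 // => j ne_j.
by rewrite mnm1E eq_sym (negbTE ne_j) muln0.
Qed.

Lemma mdeg_le_wdeg (a : 'X_{1..N}) :
  (forall i, (0 < k i)%N) -> (mdeg a <= wdeg a)%N.
Proof.
by move=> k_gt0; rewrite mdegE; apply: leq_sum => i _; rewrite leq_pmull.
Qed.

Context (R : fieldType) (m : nat).

Definition wdeg_le : {pred {mpoly R[N]}} :=
  fun p => all (fun a => (wdeg a <= m)%N) (msupp p).

Lemma wdeg_leP (p : {mpoly R[N]}) :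
  reflect {in msupp p, forall a, (wdeg a <= m)%N} (p \in wdeg_le).
Proof. exact: allP. Qed.

Lemma wdeg_le_submod_closed : submod_closed wdeg_le.
Proof.
split=> [|c p q /wdeg_leP hp /wdeg_leP hq].
  by apply/wdeg_leP => a; rewrite msupp0.
apply/wdeg_leP => a /msuppD_le; rewrite mem_cat => /orP[/msuppZ_le|];
  [exact: hp | exact: hq].
Qed.

HB.instance Definition _ :=
  GRing.isSubmodClosed.Build R {mpoly R[N]} wdeg_le wdeg_le_submod_closed.

Lemma wdeg_leX (a : 'X_{1..N}) :
  ('X_[a] \in wdeg_le) = (wdeg a <= m)%N.
Proof. by rewrite unfold_in /= msuppX /= andbT. Qed.

(* [wdeg_le] is exactly the linear span of the monomials e_{i_1} ... e_{i_l}
   with k_{i_1} + ... + k_{i_l} <= m (the empty word giving 1). *)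
Lemma wdeg_le_spanP (p : {mpoly R[N]}) :
  (p \in wdeg_le) <->
  exists2 s : seq (R * seq 'I_N),
    {in s, forall t, (\sum_(i <- t.2) k i <= m)%N} &
    p = \sum_(t <- s) t.1 *: \prod_(i <- t.2) 'X_i.
Proof.
have monE (w : seq 'I_N) :
    \prod_(i <- w) 'X_i = 'X_[\sum_(i <- w) U_(i)] :> {mpoly R[N]}.
  by rewrite mprodXE.
split=> [/wdeg_leP hp|[s hs ->]]; last first.
  rewrite big_seq; apply: rpred_sum => t ts; apply: rpredZ.
  by rewrite monE wdeg_leX big_tnth wdeg_word (leq_trans _ (hs t ts)) // [leqRHS]big_tnth.
pose word (a : 'X_{1..N}) : seq 'I_N :=
  flatten [seq nseq (a i) i | i <- enum 'I_N].
exists [seq (p@_a, word a) | a <- msupp p] => [_ /mapP[a ap ->] /=|].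
  rewrite (leq_trans _ (hp a ap)) // /wdeg big_flatten big_map big_enum /=.
  apply: leq_sum => i _.
  by rewrite big_nseq iter_addn_0.
rewrite big_map [LHS]mpolyE; apply: eq_bigr => a _ /=; congr (_ *: _).
rewrite mpolyXE_id big_flatten big_map big_enum /=; apply: eq_bigr => i _.
by rewrite big_nseq iter_mulr_1.
Qed.

End WeightedDegree.

(* The space of polynomials of weighted degree at most m.  The positivity of
   the weights is a parameter because it is what makes the space
   finite-dimensional. *)
Record wpoly (R : fieldType) (N : nat) (k : 'I_N -> nat)
    (k_gt0 : forall i, (0 < k i)%N) (m : nat) :=
  WPoly { mpoly_of_wpoly :> {mpoly R[N]};
          _ : mpoly_of_wpoly \in wdeg_le k m }.

Section WPoly.
Context (R : fieldType) (N : nat) (k : 'I_N -> nat).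
Context (k_gt0 : forall i, (0 < k i)%N) (m : nat).

Local Notation wpoly := (wpoly R k_gt0 m).
Local Notation mpoly_of_wpoly := (@mpoly_of_wpoly R N k k_gt0 m).

HB.instance Definition _ := [isSub for mpoly_of_wpoly].
HB.instance Definition _ := [Choice of wpoly by <:].
HB.instance Definition _ := [SubChoice_isSubLmodule of wpoly by <:].

Lemma wpolyP (p : wpoly) : mpoly_of_wpoly p \in wdeg_le k m.
Proof. by case: p. Qed.

Lemma mpoly_of_wpoly_is_linear : linear mpoly_of_wpoly.
Proof. by []. Qed.

HB.instance Definition _ :=
  GRing.isLinear.Build R wpoly {mpoly R[N]} _ mpoly_of_wpoly
    mpoly_of_wpoly_is_linear.

Definition wmonoms : seq 'X_{1..N} :=
  [seq val a | a <- enum [pred a : 'X_{1..N < m.+1} | (wdeg k (val a) <= m)%N]].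

Lemma mem_wmonoms (a : 'X_{1..N}) : (a \in wmonoms) = (wdeg k a <= m)%N.
Proof.
apply/mapP/idP => [[b + ->]|ha]; first by rewrite mem_enum.
have ltam : (mdeg a < m.+1)%N by rewrite ltnS (leq_trans (mdeg_le_wdeg a k_gt0)).
by exists (BMultinom ltam); rewrite ?mem_enum.
Qed.

Lemma wmonoms_uniq : uniq wmonoms.
Proof. by rewrite map_inj_uniq ?enum_uniq //; exact: val_inj. Qed.

Lemma wpoly_vecaxiom : vector_axiom (size wmonoms) wpoly.
Proof.
pose f (p : wpoly) : 'rV[R]_(size wmonoms) := \row_i p@_(tnth (in_tuple wmonoms) i).
exists f => [c p q|]; first by apply/rowP => j; rewrite !mxE /= mcoeffD mcoeffZ.
pose g (r : 'rV[R]_(size wmonoms)) : {mpoly R[N]} :=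
  \sum_i r 0 i *: 'X_[tnth (in_tuple wmonoms) i].
have g_le r : g r \in wdeg_le k m.
  apply: rpred_sum => i _; apply: rpredZ.
  by rewrite wdeg_leX -mem_wmonoms mem_tnth.
exists (fun r => WPoly k_gt0 (g_le r)) => [p|r].
  apply/val_inj/mpolyP => a /=.
  rewrite /g; under eq_bigr => i _ do rewrite mxE.
  rewrite -(big_tnth _ _ wmonoms xpredT (fun b => p@_b *: 'X_[b])) raddf_sum /=.
  under eq_bigr => b _ do rewrite mcoeffZ mcoeffX.
  have [a_in|a_notin] := boolP (a \in wmonoms).
    rewrite (bigD1_seq a) ?wmonoms_uniq //= eqxx mulr1 big1 ?addr0 // => b ne_ba.
    by rewrite (negbTE ne_ba) mulr0.
  rewrite big_seq big1 => [|b b_in].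
    apply/esym/memN_msupp_eq0; apply: contra a_notin => a_in.
    by rewrite mem_wmonoms; exact: (wdeg_leP _ _ _ (wpolyP p)).
  by case: eqP b_in a_notin => [-> ->|_ _ _] //; rewrite mulr0.
apply/rowP => j; rewrite mxE /= raddf_sum (bigD1 j) //= mcoeffZ mcoeffX eqxx mulr1.
rewrite big1 ?addr0 // => i ne_ij; rewrite mcoeffZ mcoeffX.
by rewrite (inj_eq (tuple_uniqP (in_tuple wmonoms) wmonoms_uniq)) (negbTE ne_ij) mulr0.
Qed.

#[hnf] HB.instance Definition _ :=
  Lmodule_hasFinDim.Build R wpoly wpoly_vecaxiom.

Lemma dim_wpoly : \dim {: wpoly} = size wmonoms.
Proof. by rewrite dimvf. Qed.

Definition weval (p : wpoly) (x : 'rV[R]_N) : R :=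
  (mpoly_of_wpoly p).@[fun i => x ord0 i].

End WPoly.

(* Main.v *)
Require Import Defs.
From HB Require Import structures.
From mathcomp Require Import all_boot all_order all_algebra.
From mathcomp Require Import all_classical all_reals all_analysis measurable_realfun.

Import Order.TTheory GRing.Theory Num.Theory numFieldNormedType.Exports.
Local Open Scope classical_set_scope.
Local Open Scope ring_scope.

(** Fix a finite-dimensional space of integrable functions, of dimension [d],
    and collect a basis of it in a map [f] from the points to R^d.  A quadrature
    formula with nodes in [A] is an expression of the moment vector
    [v = \int f dmu] as a combination, with positive coefficients, of vectors
    [f x] with [x] in [A]: integration is linear, so the basis functions are
    enough.  Two things have to be seen: that [v] lies in the convex cone
    spanned by [f @` A], and that [d] generators are enough; the second is
    Caratheodory's theorem for cones ([caratheodory_cone]).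

    The first is delicate because this cone need not be closed, so that a point
    outside it is only weakly separated from it: there is [c != 0] with
    [c . f x >= 0] on [A] and [c . v <= 0] ([conic_separation]).  Here the
    measure helps.  The function [x |-> c . f x] is nonnegative almost
    everywhere and has integral [c . v <= 0], so it vanishes almost everywhere
    and [c . v = 0].  Thus [mu] is concentrated on the part of [A] where [f]
    takes values in the hyperplane orthogonal to [c], which also contains [v],
    and one concludes by induction on the dimension ([conic_comb_of_filter]).
    As the argument only sees sets of full measure, it is carried out for an
    arbitrary filter, and the nodes never leave [A].

    Weak separation follows from Farkas' lemma by compactness: for finitely many
    generators a strictly separating [c] exists, it can be taken on the unit
    sphere, and finitely many closed conditions at a time being satisfiable
    there, all of them are.  Farkas' lemma itself has a short proof by induction
    on the number of generators ([farkas]).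

    For polynomials of bounded weighted degree, integrability reduces to that of
    the monomials ([integrable_weval]), and there is at least one node because
    the constant [1] has the positive integral [mu setT]. *)

Set Implicit Arguments.
Unset Strict Implicit.
Unset Printing Implicit Defensive.

(** * Farkas' lemma *)

Section Dot.
Context {R : realFieldType} {d : nat}.
Implicit Types u v w : 'rV[R]_d.

Definition dot u v : R := \sum_(j < d) u 0 j * v 0 j.

Lemma dotDl u v w : dot (u + v) w = dot u w + dot v w.
Proof.
by rewrite /dot -big_split; apply: eq_bigr => j _; rewrite mxE mulrDl.
Qed.

Lemma dotZl a u v : dot (a *: u) v = a * dot u v.
Proof. by rewrite /dot big_distrr /=; apply: eq_bigr => j _; rewrite mxE mulrA. Qed.

Lemma dotDr u v w : dot u (v + w) = dot u v + dot u w.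
Proof.
by rewrite /dot -big_split; apply: eq_bigr => j _; rewrite mxE mulrDr.
Qed.

Lemma dotZr a u v : dot u (a *: v) = a * dot u v.
Proof.
by rewrite /dot big_distrr /=; apply: eq_bigr => j _; rewrite mxE mulrCA.
Qed.

Lemma dotNr u v : dot u (- v) = - dot u v.
Proof. by rewrite -scaleN1r dotZr mulN1r. Qed.

Lemma dot0r u : dot u 0 = 0.
Proof. by rewrite -(scale0r 0) dotZr mul0r. Qed.

Lemma dot_suml n (u : 'I_n -> 'rV[R]_d) v :
  dot (\sum_i u i) v = \sum_i dot (u i) v.
Proof.
rewrite /dot exchange_big; apply: eq_bigr => j _.
by rewrite summxE mulr_suml.
Qed.

Lemma dot_self_le0 u : dot u u <= 0 -> u = 0.
Proof.
have u_ge0 j : true -> 0 <= u 0 j * u 0 j by rewrite -expr2 sqr_ge0.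
move=> u_le0; apply/rowP => j; rewrite mxE.
have /psumr_eq0P : \sum_j u 0 j * u 0 j = 0.
  by apply: le_anti; rewrite u_le0 sumr_ge0.
by move=> /(_ u_ge0) /(_ j isT)/eqP; rewrite mulf_eq0 orbb => /eqP.
Qed.

End Dot.

(** Induction on the number of generators, after Bartl.  If the generators other
    than [a ord0] already force [b] to be nonnegative, they suffice.  Otherwise
    some [c1] is nonnegative on them but negative on [b], hence also on
    [a ord0], and may be scaled so that [dot (a ord0) c1 = -1].  Sliding each
    [c] along [c1] into the hyperplane where [a ord0] vanishes amounts to
    replacing [w] by [w + dot w c1 *: a ord0]; for the vectors so modified the
    generator [a ord0] imposes nothing, and the coefficient it gets in the end
    is nonnegative by the signs of [c1]. *)
Lemma farkas (R : realFieldType) d n (a : 'I_n -> 'rV[R]_d) (b : 'rV[R]_d) :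
  (forall c, (forall i, 0 <= dot (a i) c) -> 0 <= dot b c) ->
  exists2 l : 'I_n -> R, forall i, 0 <= l i & b = \sum_i l i *: a i.
Proof.
elim: n a b => [|n IHn] a b b_ge0.
  exists (fun=> 0) => //; rewrite big_ord0; apply: dot_self_le0.
  have := b_ge0 (- b); rewrite dotNr oppr_ge0; apply; by case.
pose a' i := a (lift ord0 i).
have [b_ge0'|] :=
    pselect (forall c, (forall i, 0 <= dot (a' i) c) -> 0 <= dot b c).
  have [l l_ge0 ->] := IHn a' b b_ge0'.
  exists (fun i => oapp l 0 (unlift ord0 i)) => [i|].
    by case: unliftP => //= j _; exact: l_ge0.
  rewrite big_ord_recl unlift_none scale0r add0r.
  by apply: eq_bigr => i _; rewrite liftK.
move=> /existsNP[c0 /not_implyP[a'c0_ge0 /negP]]; rewrite -ltNge => bc0_lt0.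
have ac0_lt0 : dot (a ord0) c0 < 0.
  rewrite ltNge; apply/negP => ac0_ge0; move: bc0_lt0; rewrite ltNge b_ge0 // => i.
  by case: (unliftP ord0 i) => [j ->|->] //; exact: a'c0_ge0.
have [c1 [a'c1_ge0 bc1_le0 ac1]] : exists c1,
    [/\ forall i, 0 <= dot (a' i) c1, dot b c1 <= 0 & dot (a ord0) c1 = -1].
  have t_gt0 : 0 < - (dot (a ord0) c0)^-1 by rewrite oppr_gt0 invr_lt0.
  exists (- (dot (a ord0) c0)^-1 *: c0); split => [i||].
  - by rewrite dotZr mulr_ge0 // ltW.
  - by rewrite dotZr pmulr_rle0 // ltW.
  - by rewrite dotZr mulNr mulVf // lt_eqF.
have [l l_ge0 bE] : exists2 l : 'I_n -> R, forall i, 0 <= l i &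
    b + dot b c1 *: a ord0 = \sum_i l i *: (a' i + dot (a' i) c1 *: a ord0).
  apply: IHn => c hc.
  have shift w : dot (w + dot w c1 *: a ord0) c
      = dot w (c + dot (a ord0) c *: c1).
    by rewrite dotDl dotDr dotZl dotZr mulrC.
  rewrite shift; apply: b_ge0 => i.
  case: (unliftP ord0 i) => [j ->|->]; first by rewrite -shift; exact: hc.
  by rewrite dotDr dotZr ac1 mulrN1 subrr.
exists (fun i => if unlift ord0 i is Some j then l j
                 else \sum_j l j * dot (a' j) c1 - dot b c1) => [i|].
  case: unliftP => [j _|_]; first exact: l_ge0.
  rewrite subr_ge0 (le_trans bc1_le0) // sumr_ge0 // => j _.
  exact: mulr_ge0.
rewrite big_ord_recl unlift_none [X in _ + X](eq_bigr (fun j => l j *: a' j));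
  last by move=> j _; rewrite liftK.
apply: (addIr (dot b c1 *: a ord0)); rewrite bE.
under [LHS]eq_bigr do rewrite scalerDr scalerA.
by rewrite big_split -scaler_suml addrAC -scalerDl subrK addrC.
Qed.

(** * Conic combinations *)

(** The coefficients are only required to be nonnegative, so that [n] bounds the
    number of points that contribute; the least such [n] makes all of them
    positive, by [conic_comb_drop]. *)
Definition conic_comb (R : realFieldType) d (T : Type) (f : T -> 'rV[R]_d)
    (A : set T) (n : nat) (v : 'rV[R]_d) : Prop :=
  exists (x : 'I_n -> T) (l : 'I_n -> R),
    [/\ forall i, A (x i), forall i, 0 <= l i & v = \sum_i l i *: f (x i)].

Lemma conic_comb_drop (R : realFieldType) d (T : Type) (f : T -> 'rV[R]_d)
    (A : set T) n (x : 'I_n -> T) (l : 'I_n -> R) (i0 : 'I_n) :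
  (forall i, A (x i)) -> (forall i, 0 <= l i) -> l i0 = 0 ->
  conic_comb f A n.-1 (\sum_i l i *: f (x i)).
Proof.
move=> Ax l_ge0 li0; exists (x \o lift i0), (l \o lift i0); split => //=.
by rewrite (bigD1_ord i0) //= li0 scale0r add0r.
Qed.

(** More than [d] vectors of R^d satisfy a linear relation [u] with a positive
    coefficient.  Subtracting from the coefficients the largest multiple of [u]
    that keeps them nonnegative makes one of them vanish. *)
Lemma conic_comb_shorten (R : realFieldType) d (T : Type) (f : T -> 'rV[R]_d)
    (A : set T) n v :
  (d < n)%N -> conic_comb f A n v -> conic_comb f A n.-1 v.
Proof.
move=> ltdn [x [l [Ax l_ge0 ->]]].
pose F := \matrix_(i < n, j < d) f (x i) 0 j.
have [u uF [i1 ui1]] : exists2 u : 'rV[R]_n, u *m F = 0 & exists i, 0 < u 0 i.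
  have /rowV0Pn[u /sub_kermxP uF u_neq0] : kermx F != 0.
    by rewrite kermx_eq0 -row_leq_rank -ltnNge (leq_ltn_trans (rank_leq_col F)).
  have [i ui] : exists i, u 0 i != 0 by exact/rV0Pn.
  have [ui_lt0|ui_gt0|/eqP] := ltgtP (u 0 i) 0; last by rewrite (negPf ui).
    exists (- u); first by rewrite mulNmx uF oppr0.
    by exists i; rewrite mxE oppr_gt0.
  by exists u => //; exists i.
have ufE : \sum_i u 0 i *: f (x i) = 0.
  apply/rowP => j; have /rowP/(_ j) := uF; rewrite !mxE => <-.
  by rewrite summxE; apply: eq_bigr => i _; rewrite !mxE.
have [i0 ui0 min_i0] := arg_minP (fun i => l i / u 0 i)
  (ui1 : [pred i | 0 < u 0 i] i1).
set t := l i0 / u 0 i0 in min_i0.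
have t_ge0 : 0 <= t by rewrite divr_ge0 // ltW.
have -> : \sum_i l i *: f (x i) = \sum_i (l i - t * u 0 i) *: f (x i).
  under [RHS]eq_bigr do rewrite scalerBl -scalerA.
  by rewrite sumrB -scaler_sumr ufE scaler0 subr0.
apply: (@conic_comb_drop _ _ _ _ _ _ _ _ i0) => // [i|]; last first.
  by rewrite divfK ?gt_eqF // subrr.
rewrite subr_ge0; have [ui_le0|ui_gt0] := leP (u 0 i) 0.
  by rewrite (le_trans _ (l_ge0 i)) // mulr_ge0_le0.
by rewrite -ler_pdivlMr // min_i0.
Qed.

Lemma caratheodory_cone (R : realFieldType) d (T : Type) (f : T -> 'rV[R]_d)
    (A : set T) n v : conic_comb f A n v ->
  exists (m : nat) (x : 'I_m -> T) (l : 'I_m -> R),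
    [/\ (m <= d)%N, forall i, A (x i), forall i, 0 < l i &
        v = \sum_i l i *: f (x i)].
Proof.
move=> vn; have ex_n : exists n, `[< conic_comb f A n v >] by exists n; exact/asboolP.
case: (ex_minnP ex_n) => m /asboolP vm m_min.
have no_shorter : (0 < m)%N -> ~ conic_comb f A m.-1 v.
  by move=> m_gt0 /asboolP/m_min; rewrite leqNgt prednK ?leqnn.
have le_md : (m <= d)%N.
  rewrite leqNgt; apply/negP => ltdm; apply: no_shorter.
    exact: leq_ltn_trans ltdm.
  exact: conic_comb_shorten vm.
case: vm => x [l [Ax l_ge0 vE]]; exists m, x, l; split => // i.
rewrite lt_neqAle l_ge0 andbT eq_sym; apply/eqP => li0.
apply: no_shorter; first exact: leq_ltn_trans (ltn_ord i).
by rewrite vE; exact: conic_comb_drop li0.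
Qed.

(** * Weak separation from a cone *)

Lemma dot_continuous (R : realType) d (u : 'rV[R]_d) :
  continuous (fun c => dot u c).
Proof.
move=> c; apply: (cvg_big (@add_continuous R) (nbhs_filter c)) => j _.
apply: (@continuous_comp _ _ _ (fun w : 'rV[R]_d => w 0 j) ( *%R (u 0 j))).
  exact: coord_continuous.
exact: mulrl_continuous.
Qed.

(** The inequality for [v] is not strict, as the cone is not assumed closed; all
    that keeps [c] from being useless is [c != 0], which survives the passage
    from finite subfamilies to [A] because the [c]s are normalized. *)
Lemma conic_separation (R : realType) d (T : choiceType) (f : T -> 'rV[R]_d)
    (A : set T) (v : 'rV[R]_d) :
  (forall n, ~ conic_comb f A n v) ->
  exists2 c, c != 0 & (forall x, A x -> 0 <= dot (f x) c) /\ dot v c <= 0.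
Proof.
move=> v_out; pose S := [set c : 'rV[R]_d | `|c| = 1 /\ dot v c <= 0].
have S_compact : compact S.
  apply: bounded_closed_compact.
    exists 1; split=> // M M_gt1 c [c1 _] /=.
    by rewrite c1 ltW.
  apply: closedI.
    apply: (@preimage_closed _ _ _ [set 1 : R]) => [c _|]; last exact: closed_eq.
    exact: norm_continuous.
  apply: (@preimage_closed _ _ _ [set y : R | y <= 0]) => [c _|].
    exact: dot_continuous.
  exact: closed_le.
have finite_sep (s : seq T) : {subset s <= A} ->
    exists2 c, S c & forall x, x \in s -> 0 <= dot (f x) c.
  move=> sA; pose x (i : 'I_(size s)) := tnth (in_tuple s) i.
  have /existsNP[c /not_implyP[fc_ge0 /negP]] : ~ (forall c,
      (forall i, 0 <= dot (f (x i)) c) -> 0 <= dot v c).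
    move=> /farkas[l l_ge0 vE]; apply: (v_out (size s)); exists x, l.
    by split => // i; apply/set_mem/sA; exact: mem_tnth.
  rewrite -ltNge => vc_lt0.
  have c_neq0 : c != 0 by apply: contraTneq vc_lt0 => ->; rewrite dot0r ltxx.
  have c_gt0 : 0 < `|c|^-1 by rewrite invr_gt0 normr_gt0.
  exists (`|c|^-1 *: c); first split.
    by rewrite normrZ gtr0_norm // mulVf // normr_eq0.
    by rewrite dotZr pmulr_rle0 // ltW.
  move=> y /(tnthP (in_tuple s))[i ->]; by rewrite dotZr pmulr_rge0.
have [c [c1 vc] fc_ge0] : exists2 c, S c & forall x, A x -> 0 <= dot (f x) c.
  apply: contrapT => no_c; move: S_compact; rewrite compact_cover.
  move=> /(_ T A (fun x => [set c | dot (f x) c < 0])).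
  case=> [x _|c Sc|s sA s_cover].
  - apply: (@open_comp _ _ _ [set y : R | y < 0]) => [c _|]; last exact: open_lt.
    exact: dot_continuous.
  - apply: contrapT => c_out; apply: no_c; exists c => // x Ax.
    by rewrite leNgt; apply/negP => fxc; apply: c_out; exists x.
  - have [c Sc fc_ge0] := finite_sep (finmap.enum_fset s) sA.
    by have [x /fc_ge0] := s_cover c Sc; rewrite /= leNgt => /negPf ->.
exists c => //; rewrite -normr_gt0 c1; exact: ltr01.
Qed.

(** * Vectors that pass every positivity test *)

Lemma dot_lift (R : realFieldType) d (j : 'I_d.+1) (u : 'rV[R]_d.+1)
    (c : 'rV[R]_d) :
  dot u (\row_i oapp (c 0) 0 (unlift j i)) = dot (col' j u) c.
Proof.
rewrite /dot (bigD1_ord j) //= mxE unlift_none mulr0 add0r.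
by apply: eq_bigr => i _; rewrite !mxE liftK.
Qed.

Lemma dot_eq0_coord (R : realFieldType) d (j : 'I_d.+1) (u c : 'rV[R]_d.+1) :
  c 0 j != 0 -> dot u c = 0 ->
  u 0 j = - (c 0 j)^-1 * dot (col' j u) (col' j c).
Proof.
move=> cj; rewrite /dot (bigD1_ord j) //= => /eqP; rewrite addr_eq0 => /eqP uc.
rewrite mulNr -mulrN; under eq_bigr do rewrite !mxE.
by rewrite -uc mulrCA mulVf // mulr1.
Qed.

(** The hypothesis is what integration gives when [F] is the filter of sets of
    full measure: a function that is nonnegative on a set of [F] has a
    nonpositive mean only if it vanishes on a set of [F], and then its mean is
    zero.  Were [v] outside the cone, a weakly separating [c] would put [v] and
    the values of [f] on a smaller set of [F] in the same hyperplane [c . w = 0].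
    There a coordinate [j] with [c 0 j != 0] is a function of the others, and
    deleting it lowers the dimension: the hypothesis passes to the remaining
    coordinates by extending linear forms by zero, and a combination found for
    them is also correct at [j]. *)
Lemma conic_comb_of_filter (R : realType) d (T : choiceType)
    (F : set_system T) (FF : Filter F) (f : T -> 'rV[R]_d) (v : 'rV[R]_d)
    (A : set T) :
  (forall c, F [set x | 0 <= dot (f x) c] -> dot v c <= 0 ->
     F [set x | dot (f x) c = 0] /\ dot v c = 0) ->
  F A -> exists n, conic_comb f A n v.
Proof.
elim: d f v A => [|d IHd] f v A Fpos FA.
  have no_ord (i : 'I_0) : False by case: i.
  exists 0, (fun i => False_rect T (no_ord i)), (fun=> 0).
  by split => [[]|[]|] //; apply/rowP => -[].
apply: contrapT => /forallNP v_out.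
have [c c_neq0 [fc_ge0 vc_le0]] := conic_separation v_out.
have [j cj] : exists j, c 0 j != 0 by exact/rV0Pn.
have [Ffc0 vc0] := Fpos c (filterS fc_ge0 FA) vc_le0.
have [c' Fc' vc'|n [x [l [Ax l_ge0 vE]]]] :=
    IHd (fun x => col' j (f x)) (col' j v) (A `&` [set x | dot (f x) c = 0]) _
        (filterI FA Ffc0).
  have [] := Fpos (\row_i oapp (c' 0) 0 (unlift j i)).
  - by apply: filterS Fc' => x /=; rewrite dot_lift.
  - by rewrite dot_lift.
  - rewrite dot_lift => Fc'0 ->; split=> //.
    by apply: filterS Fc'0 => x /=; rewrite dot_lift.
apply: (v_out n); exists x, l; split => // [i|]; first by case: (Ax i).
apply/rowP => i; rewrite summxE; under eq_bigr do rewrite mxE.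
case: (unliftP j i) => [i' ->|->].
  have /rowP/(_ i') := vE; rewrite mxE => ->; rewrite summxE.
  by apply: eq_bigr => i1 _; rewrite !mxE.
rewrite (dot_eq0_coord cj vc0) vE dot_suml mulr_sumr; apply: eq_bigr => i1 _.
by case: (Ax i1) => _ /= fxc0; rewrite (dot_eq0_coord cj fxc0) dotZl mulrCA.
Qed.

(** * Quadrature for a finite-dimensional space of functions *)

Section Integral.
Context {disp : measure_display} {T : measurableType disp} {R : realType}.
Variable mu : {measure set T -> \bar R}.
Local Notation integrable g := (mu.-integrable setT (EFin \o g)).

Lemma integrable_dot d (f : T -> 'rV[R]_d) (c : 'rV[R]_d) :
  (forall j, integrable (fun x => f x 0 j)) ->
  integrable (fun x => dot (f x) c) /\
  (\int[mu]_x (dot (f x) c)%:E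
     = (dot (\row_j fine (\int[mu]_x (f x 0 j)%:E)) c)%:E)%E.
Proof.
move=> f_int; have dotE : (fun x => (dot (f x) c)%:E)
    = (fun x => \sum_(j < d) (c 0 j)%:E * (f x 0 j)%:E)%E.
  apply/funext => x; rewrite /dot -sumEFin; apply: eq_bigr => j _.
  by rewrite -EFinM mulrC.
have cf_int j : mu.-integrable setT (fun x => ((c 0 j)%:E * (f x 0 j)%:E)%E).
  exact: (integrableZl measurableT _ (f_int j)).
split; first by rewrite /comp dotE; exact: integrable_sum.
rewrite dotE integral_sum // /dot -sumEFin; apply: eq_bigr => j _.
rewrite (integralZl measurableT (f_int j)) mxE mulrC EFinM fineK //.
exact: (integrable_fin_num measurableT (f_int j)).
Qed.

Lemma integral_le0_ae_eq0 (g : T -> R) : integrable g ->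
  {ae mu, forall x, 0 <= g x} -> (\int[mu]_x (g x)%:E <= 0)%E ->
  {ae mu, forall x, g x = 0} /\ (\int[mu]_x (g x)%:E = 0)%E.
Proof.
move=> g_int g_ge0 g_le0; have g_meas := measurable_int _ g_int.
have absE : (\int[mu]_x `|(g x)%:E| = \int[mu]_x (g x)%:E)%E.
  apply: ae_eq_integral => //; first exact: (measurable_int mu (integrable_abse g_int)).
  by apply: filterS g_ge0 => x gx _; rewrite gee0_abs // lee_fin.
have abs0 : (\int[mu]_x `|(g x)%:E| = 0)%E.
  by apply/le_anti; rewrite absE g_le0 -absE integral_ge0.
split; last by rewrite -absE.
have /ae_eq_integral_abs := abs0 => /(_ measurableT g_meas).
by apply: filterS => x /(_ I) [].
Qed.

(** Caratheodory's bound is the dimension of [V] because [f] below records the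
    values of a basis of [V].  The empty formula, [n = 0], must be allowed: it is
    the only one when [mu = 0] and [V] contains a positive function. *)
Theorem tchakaloff (V : vectType R) (ev : T -> {linear V -> R^o}) (A : set T) :
  (forall p, integrable (fun x => ev x p)) -> {ae mu, forall x, A x} ->
  exists (n : nat) (x : 'I_n -> T) (lambda : 'I_n -> R),
    [/\ (n <= \dim {: V})%N, forall i, A (x i), forall i, 0 < lambda i &
        forall p, (\int[mu]_y (ev y p)%:E
                   = (\sum_(i < n) lambda i * ev (x i) p)%:E)%E].
Proof.
move=> ev_int A_ae; pose b := vbasis {: V}.
pose f x : 'rV[R]_(\dim {: V}) := \row_j ev x b`_j.
have evE p x : ev x p = dot (f x) (\row_j coord b j p).
  rewrite {1}(coord_vbasis (memvf p)) linear_sum; apply: eq_bigr => j _.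
  by rewrite linearZ !mxE mulrC.
have f_int j : integrable (fun x => f x 0 j).
  by under [X in integrable X]eq_fun do rewrite mxE.
pose v := \row_j fine (\int[mu]_x (f x 0 j)%:E).
have [|n vn] := @conic_comb_of_filter _ _ T _ (ae_filter_ringOfSetsType mu) f v A _ A_ae.
  move=> c c_ge0 vc_le0; have [g_int gE] := integrable_dot c f_int.
  have [|? g0] := integral_le0_ae_eq0 g_int c_ge0; first by rewrite gE lee_fin.
  by split => //; apply/EFin_inj; rewrite -gE.
have [m [x [l [le_m Ax l_gt0 vE]]]] := caratheodory_cone vn.
exists m, x, l; split=> // p; under eq_integral do rewrite evE.
rewrite (integrable_dot _ f_int).2 -/v vE dot_suml; congr EFin.
by apply: eq_bigr => i _; rewrite dotZl evE.
Qed.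

End Integral.

(** * Polynomials of bounded weighted degree *)

Lemma measurable_coord (R : realType) N (i : 'I_N) :
  measurable_fun setT
    (fun x : g_sigma_algebraType (@open 'rV[R]_N) => (x : 'rV[R]_N) ord0 i).
Proof.
apply: (measurability _ (RGenOpens.measurableE R)) => _ [_ [a [b ->] <-]].
apply: sub_sigma_algebra; rewrite setTI; apply: open_comp => [x _|].
  exact: coord_continuous.
exact: interval_open.
Qed.

Section Evaluation.
Context {R : realType} {N m : nat} {k : 'I_N -> nat}.
Context {k_gt0 : forall i : 'I_N, (0 < k i)%N}.
Local Notation wpoly := (wpoly R k_gt0 m).

(** [weval] with its arguments swapped, so that linearity in the polynomial can be
    attached to it. *)
Definition eval_at (x : 'rV[R]_N) (p : wpoly) : R^o := weval p x.

Lemma eval_at_is_linear x : linear (eval_at x).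
Proof. by move=> c p q; rewrite /eval_at /weval mpoly.mevalD mpoly.mevalZ. Qed.

HB.instance Definition _ x :=
  GRing.isLinear.Build R wpoly R^o _ (eval_at x) (eval_at_is_linear x).

(** The monomials appear as words in the variables, which is the form in which
    their integrability is given. *)
Lemma weval_monomials (p : wpoly) : exists2 s : seq (R * seq 'I_N),
  {in s, forall t, (\sum_(i <- t.2) k i <= m)%N} &
  forall x, weval p x = \sum_(t <- s) t.1 * \prod_(i <- t.2) x ord0 i.
Proof.
have [s s_le pE] := (wdeg_le_spanP k m p).1 (wpolyP p); exists s => // x.
rewrite /weval pE (big_morph _ (mpoly.mevalD _) (mpoly.meval0 _)).
apply: eq_bigr => t _ /=.
rewrite mpoly.mevalZ (big_morph _ (mpoly.mevalM _) (mpoly.meval1 _)).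
congr (_ * _); apply: eq_bigr => i _.
exact: mpoly.mevalXU.
Qed.

Lemma weval_one : exists p : wpoly, forall x, weval p x = 1.
Proof.
pose one := mpoly.mpolyX R (mpoly.mnm0 (n := N)).
have one_le : one \in wdeg_le k m.
  by rewrite wdeg_leX /wdeg big1 // => i _; rewrite mpoly.mnm0E muln0.
exists (WPoly k_gt0 one_le) => x; rewrite /weval mpoly.mevalX big1 // => i _.
by rewrite mpoly.mnm0E.
Qed.

End Evaluation.

Lemma integrable_weval (R : realType) (N m : nat) (k : 'I_N -> nat)
    (k_gt0 : forall i : 'I_N, (0 < k i)%N)
    (mu : {measure set (g_sigma_algebraType (@open 'rV[R]_N)) -> \bar R})
    (hint : forall (l : nat) (i : 'I_l -> 'I_N),
        (\sum_(r < l) k (i r) <= m)%N ->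
        (\int[mu]_(x in setT)
           (`| \prod_(r < l) (x : 'rV[R]_N) ord0 (i r) |)%:E < +oo)%E)
    (p : wpoly R k_gt0 m) :
  mu.-integrable setT (EFin \o weval p).
Proof.
have [s s_le pE] := weval_monomials p.
have -> : EFin \o weval p = (fun x => \sum_(t <- s | t \in s)
    (t.1)%:E * (\prod_(i <- t.2) (x : 'rV[R]_N) ord0 i)%:E)%E.
  by apply/funext => x; rewrite /= pE -big_seq -sumEFin.
apply: (integrable_sum measurableT) => t ts.
have prod_int : mu.-integrable setT (EFin \o (fun x => \prod_(i <- t.2)
    (x : 'rV[R]_N) ord0 i)).
  apply/integrableP; split.
    apply/measurable_EFinP; apply: measurable_prod => i _.
    exact: measurable_coord.
  under eq_integral do rewrite /= big_tnth.
  apply: (hint (size t.2) (tnth (in_tuple t.2))).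
  by have := s_le t ts; rewrite big_tnth.
exact: (integrableZl measurableT _ prod_int).
Qed.

Theorem theorem2 (R : realType) (N m : nat) (hN : (1 <= N)%N) (hm : (1 <= m)%N)
    (k : 'I_N -> nat) (k_gt0 : forall i : 'I_N, (0 < k i)%N)
    (mu : {finite_measure set (g_sigma_algebraType (@open 'rV[R]_N)) -> \bar R})
    (mu_gt0 : (0 < mu setT)%E)
    (A : set (g_sigma_algebraType (@open 'rV[R]_N)))
    (mA : measurable A) (muA : mu (~` A) = 0%E)
    (hint : forall (l : nat) (i : 'I_l -> 'I_N),
        (\sum_(r < l) k (i r) <= m)%N ->
        (\int[mu]_(x in setT)
           (`| \prod_(r < l) (x : 'rV[R]_N) ord0 (i r) |)%:E < +oo)%E) :
  exists (n : nat) (x : 'I_n -> 'rV[R]_N) (lambda : 'I_n -> R),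
    [/\ (1 <= n <= \dim {: wpoly R k_gt0 m})%N,
        forall i, A (x i),
        forall i, 0 < lambda i &
        forall P : wpoly R k_gt0 m,
          (\int[mu]_(y in setT) (weval P y)%:E
             = (\sum_(i < n) lambda i * weval P (x i))%:E)%E].
Proof.
have weval_int (p : wpoly R k_gt0 m) := integrable_weval hint p.
have A_ae : {ae mu, forall x, A x} by exists (~` A); split => //; exact: measurableC.
have [n [x [l [le_n Ax l_gt0 muE]]]] :=
  @tchakaloff _ _ _ mu (wpoly R k_gt0 m) (@eval_at R N m k k_gt0) A weval_int A_ae.
exists n, x, l; split=> //; rewrite le_n andbT.
(* Without nodes the formula would give 1 the integral 0 instead of mu setT. *)
rewrite lt0n; apply/eqP => n0; have [one oneE] := @weval_one R N m k k_gt0.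
move: mu_gt0; have := muE one; rewrite big1 => [|i _]; last first.
  by have := ltn_ord i; rewrite [X in (_ < X)%N]n0.
under eq_integral do rewrite /= /eval_at oneE.
by rewrite integral_cst // mul1e => ->; rewrite ltxx.
Qed.
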